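(* Let $k$ be a positive integer and $t$ a nonnegative integer. Suppose $G$ is a graph and $L$ is a $k$-assignment for $G$ with palette $\mathcal{L}$ such that $$\max_{c \in \mathcal{L}} \eta(c) < 2k .$$ If there exists a proper $L$-coloring of $G$ with respect to which at most $t$ colors in $\mathcal{L}$ are excessive, then there exists a proper $L$-coloring $g$ of $G$ such that no color in $\mathcal{L}$ is deficient with respect to $g$ and at most $t$ colors in $\mathcal{L}$ are excessive with respect to $g$. In particular, if there is a proper $L$-coloring of $G$ with respect to which no color in $\mathcal{L}$ is excessive, then $G$ has a proportional $L$-coloring.
   Context: All graphs are finite and simple. A $k$-assignment $L$ for a graph $G$ assigns to each vertex $v$ a set $L(v)$ of exactly $k$ colors; its palette is $\mathcal{L} = \bigcup_{v \in V(G)} L(v)$, and for $c \in \mathcal{L}$, $\eta(c) = |\{v \in V(G) : c \in L(v)\}|$. A proper $L$-coloring of $G$ is a proper coloring $f$ of $G$ with $f(v) \in L(v)$ for every vertex $v$. A color $c \in \mathcal{L}$ is excessive with respect to $f$ if $|f^{-1}(c)| > \lceil \eta(c)/k \rceil$, and deficient with respect to $f$ if $|f^{-1}(c)| < \lfloor \eta(c)/k \rfloor$. A proportional $L$-coloring is a proper $L$-coloring $f$ such that for every $c \in \mathcal{L}$, $|f^{-1}(c)|$ equals $\lfloor \eta(c)/k \rfloor$ or $\lceil \eta(c)/k \rceil$. *)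

(* Defs.v *)
(* Mathematical Components, with finmap for finite sets of colors. *)
From mathcomp Require Import all_boot finmap.

Set Implicit Arguments.
Unset Strict Implicit.
Unset Printing Implicit Defensive.

(* Natural number ceiling of n / k, for k > 0. *)
Definition ceil_div (n k : nat) : nat := (n + k.-1) %/ k.

(* A finite simple graph is a finite vertex type with an adjacency relation. *)
Definition simple_graph (V : finType) (adj : rel V) : Prop :=
  symmetric adj /\ irreflexive adj.

Section ListColoring.

Variables (V : finType) (C : choiceType).
Implicit Types (adj : rel V) (k : nat) (L : V -> {fset C}) (f : V -> C).

Definition assignment k L : Prop := forall v, #|` L v|%fset = k.

Definition palette L : {fset C} := (\bigcup_(v in V) L v)%fset.

Definition eta L (c : C) : nat := #|[set v | c \in L v]|.

Definition proper_coloring adj L f : Prop :=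
  (forall u v, adj u v -> f u != f v) /\ (forall v, f v \in L v).

Definition class_size f (c : C) : nat := #|[set v | f v == c]|.

Definition excessive k L f (c : C) : bool :=
  ceil_div (eta L c) k < class_size f c.

Definition deficient k L f (c : C) : bool :=
  class_size f c < eta L c %/ k.

Definition num_excessive k L f : nat :=
  #|` [fset c in palette L | excessive k L f c]|%fset.

Definition proportional_coloring adj k L f : Prop :=
  proper_coloring adj L f /\
  (forall c, c \in palette L ->
     class_size f c = eta L c %/ k \/ class_size f c = ceil_div (eta L c) k).

End ListColoring.

(* Main.v *)
(** Since [eta < 2k], a color is deficient only when it is unused and at least
    [k] vertices list it.  Given a deficient color [c], recolor a vertex [v0]
    listing [c] with [c], then a vertex [v1] listing [f v0] with [f v0], and so
    on along a path, stopping at the first vertex [v] whose color can lose a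
    vertex without becoming deficient.  Each intermediate color labels a single
    vertex, so the coloring stays proper; only [c] gains a vertex and only the
    color of [v] loses one.  Such a path exists: otherwise the set [W] of
    vertices reachable this way has pairwise distinct colors, and these together
    with [c] form [#|W| + 1] colors, each listed by at least [k] vertices, all
    of them in [W], although [W] offers only [k * #|W|] listings. *)
Require Import Defs.
From mathcomp Require Import all_boot finmap.

Set Implicit Arguments.
Unset Strict Implicit.
Unset Printing Implicit Defensive.

Section Deficiency.

Variables (V : finType) (C : choiceType) (adj : rel V) (k : nat).
Variable L : V -> {fset C}.
Hypotheses (k_gt0 : 0 < k) (simpleG : simple_graph adj).
Hypothesis assignL : assignment k L.
Implicit Types (f g : V -> C) (c d x : C) (u v : V).

Definition recolor f v c : V -> C := fun u => if u == v then c else f u.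

(** Such a color can lose a vertex without becoming deficient: once [eta] is below [2 * k], the
    floor is 0 in the first case and at most 1 in the second. *)
Definition expendable f d : bool := (eta L d < k) || (1 < class_size f d).

Lemma class_size_gt0 f v : 0 < class_size f (f v).
Proof. by apply/card_gt0P; exists v; rewrite inE. Qed.

Lemma class_size0P f c : class_size f c = 0 -> forall v, f v != c.
Proof.
move=> c0 v; apply/eqP => fv.
by have := class_size_gt0 f v; rewrite fv c0.
Qed.

Lemma class_size1P f u v : class_size f (f v) <= 1 -> f u = f v -> u = v.
Proof.
by move=> /card_le1_eqP le1 fu; apply: le1; rewrite inE ?fu.
Qed.

(** Booleans count as 0 or 1 and the losing color is added on the left: this avoids truncated
    subtraction and lets successive recolorings telescope. *)
Lemma class_size_recolor f v c x :
  f v != c ->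
  class_size (recolor f v c) x + (x == f v) = class_size f x + (x == c).
Proof.
move=> fvc; rewrite /class_size (cardsD1 v) [in RHS](cardsD1 v) !inE.
rewrite {1}/recolor eqxx (eq_sym c) (eq_sym (f v)).
suff -> : [set u | recolor f v c u == x] :\ v = [set u | f u == x] :\ v.
  by rewrite addnC addnCA addnC.
by apply/setP => u; rewrite !inE /recolor; case: eqP.
Qed.

Lemma proper_recolor f v c :
  proper_coloring adj L f -> class_size f c = 0 -> c \in L v ->
  proper_coloring adj L (recolor f v c).
Proof.
move=> [fP fL] /class_size0P c0 cLv; have [_ irr] := simpleG.
split=> [u w|u]; rewrite /recolor; last by case: eqP => [->|].
case: (u =P v) => [->|_]; case: (w =P v) => [->|_] //; first by rewrite irr.
- by rewrite eq_sym.
- exact: fP.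
Qed.

Lemma shift_along_path f c v (p : seq V) :
    proper_coloring adj L f -> class_size f c = 0 -> c \in L v ->
    path (fun u w => f u \in L w) v p -> uniq (v :: p) ->
    expendable f (f (last v p)) ->
  exists g d, [/\ proper_coloring adj L g, d \in map f (v :: p), expendable f d
    & forall x, class_size g x + (x == d) = class_size f x + (x == c)].
Proof.
elim: p f c v => [|w p IHp] f c v fP c0 cLv pathp uniqp good.
  exists (recolor f v c), (f v); split=> //; first exact: proper_recolor.
    by rewrite mem_head.
  by move=> x; apply/class_size_recolor/class_size0P.
have fvc := class_size0P c0 v.
have rsz x := class_size_recolor x fvc.
have [fvE|] := boolP (expendable f (f v)).
  exists (recolor f v c), (f v); split=> //; first exact: proper_recolor.
  by rewrite mem_head.
rewrite negb_or -!leqNgt => /andP[_ fv1].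
have fvsz : class_size f (f v) = 1.
  by apply/eqP; rewrite eqn_leq fv1 class_size_gt0.
move: pathp uniqp => /= /andP[fvw pathp] /andP[vNwp uniqp].
have off u : u \in w :: p -> recolor f v c u = f u.
  by rewrite /recolor; case: eqP => // -> vwp; rewrite vwp in vNwp.
have expE u : u \in w :: p ->
    expendable (recolor f v c) (f u) = expendable f (f u).
  move=> uwp; have := rsz (f u); rewrite (negPf (class_size0P c0 u)).
  suff /negPf-> : f u != f v by rewrite /expendable !addn0 => ->.
  by apply: contraNneq vNwp => /(class_size1P fv1) <-.
have [g [d [gP dwp dE gsz]]] : exists g d, [/\ proper_coloring adj L g,
    d \in map (recolor f v c) (w :: p), expendable (recolor f v c) d
    & forall x, class_size g x + (x == d)
                = class_size (recolor f v c) x + (x == f v)].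
  apply: (IHp _ _ w) => //.
  - exact: proper_recolor.
  - by have := rsz (f v); rewrite eqxx (negPf fvc) fvsz addn1 => -[].
  - rewrite (@eq_in_path _ (mem (w :: p)) _ (fun u w => f u \in L w)) //.
      by move=> u z uwp _; rewrite off.
    exact/allP.
  - by rewrite off ?expE ?mem_last.
case/mapP: dwp => u uwp; rewrite off // => du.
exists g, d; split=> //; last by move=> x; rewrite gsz rsz.
- by rewrite du; apply: (@map_f _ _ f (v :: w :: p)); rewrite in_cons uwp orbT.
- by rewrite du -expE // -du.
Qed.

(** Double counting of the pairs [(s, v)] with [s \in S] and [s \in L v]. *)
Lemma card_le_listing (S : seq C) (W : {set V}) :
    uniq S -> (forall s, s \in S -> k <= eta L s) ->
    (forall s v, s \in S -> s \in L v -> v \in W) ->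
  size S <= #|W|.
Proof.
move=> uniqS etaS SW; rewrite -(leq_pmul2r k_gt0).
apply: (@leq_trans (\sum_(s <- S) eta L s)).
  rewrite -sum1_size big_distrl /= !big_seq leq_sum // => s sS.
  by rewrite mul1n etaS.
have -> : \sum_(s <- S) eta L s = \sum_(s <- S) \sum_(v in W) (s \in L v).
  apply: eq_big_seq => s sS; rewrite /eta -sum1_card big_mkcond [RHS]big_mkcond.
  apply: eq_bigr => v _; rewrite inE; case: ifP => [/(SW _ _ sS)->//|_].
  by rewrite if_same.
(* Counted by vertices, each [v] in [W] lists at most [k] colors of the duplicate-free [S]. *)
rewrite exchange_big /= -sum_nat_const leq_sum // => v _.
rewrite -big_mkcond /= sum1_count -size_filter -(assignL v).
apply: uniq_leq_size; first exact: filter_uniq.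
by move=> s; rewrite mem_filter => /andP[].
Qed.

Lemma exists_expendable_path f c :
    proper_coloring adj L f -> class_size f c = 0 -> k <= eta L c ->
  exists v p, [/\ c \in L v, path (fun u w => f u \in L w) v p,
    uniq (v :: p) & expendable f (f (last v p))].
Proof.
move=> [_ fL] c0 etac; pose e u w := f u \in L w.
pose W := [set w | [exists v, (c \in L v) && connect e v w]].
have [w wE|none] := pickP [pred w in W | expendable f (f w)].
  case/andP: wE; rewrite inE => /existsP[v /andP[cLv /connectP[p pathp ->]]].
  (* Cutting out cycles keeps the endpoint and makes the vertices distinct. *)
  case/shortenP: pathp => q pathq uniqq _ good.
  by exists v, q.
have lone w : w \in W -> (k <= eta L (f w)) && (class_size f (f w) <= 1).
  move=> wW; have := none w; rewrite /= wW => /negbT.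
  by rewrite negb_or -!leqNgt.
have fW : {in W &, injective f}.
  by move=> u w _ /lone/andP[_ w1]; apply: class_size1P.
suff: size (c :: [seq f w | w <- enum W]) <= #|W|.
  by rewrite /= size_map -cardE ltnn.
apply: card_le_listing.
- rewrite /= map_inj_in_uniq ?enum_uniq ?andbT.
    by apply/mapP => -[w _ /esym/eqP]; apply/negP/class_size0P.
  by move=> u w; rewrite !mem_enum; apply: fW.
- move=> s; rewrite inE => /predU1P[->//|/mapP[w]].
  by rewrite mem_enum => /lone/andP[? _] ->.
(* [W] contains every vertex listing [c] and, with each [w], every vertex listing [f w]. *)
- move=> s v; rewrite inE => /predU1P[->|/mapP[w]].
    by move=> cLv; rewrite inE; apply/existsP; exists v; rewrite cLv /=.
  rewrite mem_enum inE => /existsP[u /andP[cLu uw]] -> fwv.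
  rewrite inE; apply/existsP; exists u; rewrite cLu /=.
  exact/(connect_trans uw)/connect1.
Qed.

Lemma ceil_div_gt0 n : 0 < n -> 0 < ceil_div n k.
Proof. by move=> n0; rewrite divn_gt0 // -{1}(prednK k_gt0) -add1n leq_add2r. Qed.

Lemma ceil_div_le n : ceil_div n k <= (n %/ k).+1.
Proof.
have := leq_div2r k (leq_add (leqnn n) (leq_pred k)).
by rewrite [leqRHS]divnDr // divnn k_gt0 addn1.
Qed.

Hypothesis eta_lt : forall c, c \in palette L -> eta L c < 2 * k.

(** The bound on [eta] leaves only 0 and 1 as floors, and a floor of 0 excludes deficiency. *)
Lemma deficientE f c :
  c \in palette L -> deficient k L f c = (class_size f c == 0) && (k <= eta L c).
Proof.
move=> /eta_lt; rewrite -ltn_divLR // /deficient -(divn_gt0 _ k_gt0).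
by case: (_ %/ _) => [|[|]] // _; rewrite ?andbF // ltnS leqn0 andbT.
Qed.

Definition deficient_set f := [fset c in palette L | deficient k L f c]%fset.

(** Shifting along a path makes [c] grow from 0 to 1 vertex and an expendable [d] lose one; all
    other classes keep their size. *)
Lemma fill_deficient f c :
    proper_coloring adj L f -> c \in palette L -> deficient k L f c ->
  exists g, [/\ proper_coloring adj L g,
    (deficient_set g `<` deficient_set f)%fset
    & forall x, excessive k L g x -> excessive k L f x].
Proof.
move=> fP cL cdef; move: (cdef); rewrite deficientE // => /andP[/eqP c0 etac].
have [v [p [cLv pathp uniqp good]]] := exists_expendable_path fP c0 etac.
have [g [d [gP /mapP[u _ du] dE gsz]]] :=
  shift_along_path fP c0 cLv pathp uniqp good.
have dc : d != c by rewrite du class_size0P.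
have gc : class_size g c = 1.
  by have := gsz c; rewrite eqxx eq_sym (negPf dc) c0 addn0.
have gle x : x != c -> class_size g x <= class_size f x.
  by move=> /negPf xc; have := gsz x; rewrite xc addn0 => <-; apply: leq_addr.
exists g; split=> // [|x].
  rewrite fproperE; apply/andP; split; last first.
    apply/fsubsetPn; exists c; first by rewrite !inE cL.
    by rewrite !inE cL deficientE // gc.
  apply/fsubsetP => x.
  rewrite !inE => /andP[xL]; rewrite xL !deficientE // => /andP[/eqP gx etax].
  rewrite etax andbT; have := gsz x; rewrite gx.
  have xc : x != c by apply: contra_eqN gx => /eqP->; rewrite gc.
  rewrite (negPf xc) addn0; have [xd|_ <-//] := eqVneq x d.
  by move: dE; rewrite /expendable -xd ltnNge etax /= => /[swap] <-.
have [->|xc] := eqVneq x c; last first.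
  by rewrite /excessive => /leq_trans; apply; apply: gle.
(* A single vertex is never too many, since [eta L c] is positive. *)
by rewrite /excessive gc ltnNge ceil_div_gt0 // (leq_trans k_gt0).
Qed.

(** Induction on the number of deficient colors, which each filling strictly lowers. *)
Lemma fill_all_deficient f :
    proper_coloring adj L f ->
  exists g, [/\ proper_coloring adj L g,
    forall c, c \in palette L -> ~~ deficient k L g c
    & forall x, excessive k L g x -> excessive k L f x].
Proof.
have [n] := ubnP #|` deficient_set f|%fset.
elim: n f => // n IHn f; rewrite ltnS => dfn fP.
have [def0|[c]] := fset_0Vmem (deficient_set f).
  exists f; split=> // c cL; apply/negP => cdef.
  have: c \in deficient_set f by rewrite !inE cL.
  by rewrite def0 inE.
rewrite !inE => /andP[cL cdef].
have [g [gP gf fg]] := fill_deficient fP cL cdef.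
have [|h [hP hdef gh]] := IHn g _ gP.
  by apply: leq_trans dfn; apply: fproper_ltn_card.
by exists h; split=> // x /gh/fg.
Qed.

End Deficiency.

Theorem lemma29 (k t : nat) (V : finType) (adj : rel V) (C : choiceType)
    (L : V -> {fset C})
    (k_gt0 : 0 < k)
    (simpleG : simple_graph adj)
    (assignL : assignment k L)
    (eta_lt : \max_(c <- palette L) eta L c < 2 * k) :
  ((exists f : V -> C,
      proper_coloring adj L f /\ num_excessive k L f <= t) ->
   exists g : V -> C,
     [/\ proper_coloring adj L g,
         (forall c, c \in palette L -> ~~ deficient k L g c)
       & num_excessive k L g <= t])
  /\
  ((exists f : V -> C,
      proper_coloring adj L f /\
      (forall c, c \in palette L -> ~~ excessive k L f c)) ->
   exists g : V -> C, proportional_coloring adj k L g).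
Proof.
have etaP c : c \in palette L -> eta L c < 2 * k.
  move=> cL; apply: leq_ltn_trans eta_lt.
  exact: (@leq_bigmax_seq _ _ xpredT).
split=> [[f [fP ft]]|[f [fP fexc]]];
  have [g [gP gdef gf]] := fill_all_deficient k_gt0 simpleG assignL etaP fP.
  exists g; split=> //; apply: leq_trans ft; apply: fsubset_leq_card.
  by apply/fsubsetP => x; rewrite !inE => /andP[-> /gf].
exists g; split=> // c cL.
have lo : eta L c %/ k <= class_size g c by rewrite leqNgt; apply: gdef.
have hi : class_size g c <= ceil_div (eta L c) k.
  by rewrite leqNgt; apply: contra (fexc c cL); apply: gf.
(* Floor and ceiling differ by at most 1, so a size above the floor reaches the ceiling. *)
have [->|ne] := eqVneq (class_size g c) (eta L c %/ k); [by left|right].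
apply/eqP; rewrite eqn_leq hi /=; apply: leq_trans (ceil_div_le k_gt0 _) _.
by rewrite ltn_neqAle eq_sym ne.
Qed.
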